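(* Let $k\in\mathbb{N}$ and $1<c<H_k$. For every $\varepsilon>0$ there exists $n_\varepsilon$ such that a strictly $c$-competitive paging algorithm with a cache of size $k$ must read at least $$b\geq K_{\frac{1}{k+1}}\!\left(\frac{c}{(k+1)H_k-\varepsilon}+\frac{c}{n}\right)n$$ bits of advice on inputs of length $n\geq n_\varepsilon$.
   Context: Paging: a cache holds $k$ pages (with an initial cache content); requests are pages; if a requested page is not in the cache (a page fault) the algorithm must load it, evicting a page if the cache is full; the cost is the number of page faults, and $n$ is the number of requests. An algorithm is strictly $c$-competitive if its cost is at most $c\,\mathrm{OPT}(\sigma)$ for every input $\sigma$. Advice is read from an infinite tape prepared by an oracle knowing the whole input. $H_k=\sum_{i=1}^k1/i$. $K_y(x)=x\log_2(x/y)+(1-x)\log_2((1-x)/(1-y))$.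
   Formalization: The bound is proved for 0 < ε < (k+1)(H_k − c), not for every ε > 0; for large ε the claimed bound is undefined or false (e.g. k=2, c=1.2, ε=3.2 would demand more than the n+k advice bits that suffice for optimality). *)

(* Defs.v *)
From HB Require Import structures.
From mathcomp Require Import all_boot all_order all_algebra.
From mathcomp Require Import reals exp.
Set Implicit Arguments. Unset Strict Implicit. Unset Printing Implicit Defensive.
Import Order.TTheory GRing.Theory Num.Theory.

(* ---------- Paging model ----------
   Pages are natural numbers.  A cache of size k is a function from the k
   slots 'I_k to pages.  The initial cache holds k distinct pages, so under
   demand paging the cache is always full: on a fault the requested page
   replaces the page in the slot chosen by the algorithm; on a hit nothing
   happens. *)

Section Paging.
Variable k : nat.

Definition cache := {ffun 'I_k -> nat}.

Definition in_cache (C : cache) (p : nat) : bool := [exists i, C i == p].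

Definition serve (C : cache) (p : nat) (i : 'I_k) : cache :=
  if in_cache C p then C else [ffun j => if j == i then p else C j].

(* A (deterministic) eviction rule: given the previous requests and the
   current request, the slot to evict. *)
Definition decision := seq nat -> nat -> 'I_k.

Fixpoint trace_from (d : decision) (pre : seq nat) (C : cache) (s : seq nat)
  : seq cache :=
  match s with
  | [::] => [::]
  | p :: s' => let C' := serve C p (d pre p) in C' :: trace_from d (rcons pre p) C' s'
  end.

Fixpoint faults_from (d : decision) (pre : seq nat) (C : cache) (s : seq nat)
  : nat :=
  match s with
  | [::] => 0%N
  | p :: s' => ((~~ in_cache C p) + faults_from d (rcons pre p) (serve C p (d pre p)) s')%N
  end.

Definition cost (C0 : cache) (d : decision) (s : seq nat) : nat :=
  faults_from d [::] C0 s.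

(* m = OPT(s): the minimum cost over all (offline) eviction strategies.
   Since the input s is fixed, an arbitrary decision function models an
   arbitrary offline demand-paging strategy. *)
Definition is_opt (C0 : cache) (s : seq nat) (m : nat) : Prop :=
  (exists d : decision, cost C0 d s = m) /\ (forall d : decision, (m <= cost C0 d s)%N).

(* Online algorithm with advice: reads the infinite advice tape (nat -> bool). *)
Definition advice_alg := (nat -> bool) -> decision.

Definition oracle := seq nat -> (nat -> bool).

Definition strictly_competitive (R : realType) (C0 : cache) (A : advice_alg)
  (O : oracle) (c : R) : Prop :=
  forall (s : seq nat) (m : nat), is_opt C0 s m ->
    ((cost C0 (A (O s)) s)%:R <= c * m%:R)%R.

(* On input s with tape phi, the run of A depends only on the first b bits
   of the tape (in particular this holds if A reads at most b bits). *)
Definition reads_at_most (C0 : cache) (A : advice_alg) (phi : nat -> bool)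
  (s : seq nat) (b : nat) : Prop :=
  forall psi : nat -> bool, (forall i, (i < b)%N -> psi i = phi i) ->
    trace_from (A psi) [::] C0 s = trace_from (A phi) [::] C0 s.

End Paging.

Local Open Scope ring_scope.

Definition harmonic (R : realType) (k : nat) : R :=
  \sum_(1 <= i < k.+1) (i%:R)^-1.

Definition log2 (R : realType) (x : R) : R := ln x / ln 2.

Definition KL (R : realType) (y x : R) : R :=
  x * log2 (x / y) + (1 - x) * log2 ((1 - x) / (1 - y)).

(* Main.v *)
(* Only k + 1 pages are requested, so the cache always misses exactly one of
   them. Write t^cost for the weight of a request sequence; over all (k + 1)^n
   sequences, a fixed eviction rule has total weight (k + t)^n, so b bits of
   advice give at most 2^b (k + t)^n when t <= 1. On the other hand OPT is at
   most the number of new phases, whose mean is at most n / ((k + 1) H_k) + 1 by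
   a potential argument, so by Jensen's inequality a c-competitive algorithm has
   total weight at least (k + 1)^n t^(x n), with x as in the bound. Comparing
   the two at t = x k / (1 - x) gives the divergence exactly, with no error term:
   a large n is needed only to ensure x <= 1 / (k + 1), that is t <= 1. *)

(* Loaded before Defs because it has its own [harmonic], which must be shadowed. *)
From mathcomp Require Import sequences.
Require Import Defs.
From HB Require Import structures.
From mathcomp Require Import all_boot all_order all_algebra.
From mathcomp Require Import boolp reals exp.
From mathcomp Require Import ring lra zify.
Set Implicit Arguments.
Unset Strict Implicit.
Unset Printing Implicit Defensive.
Import Order.TTheory GRing.Theory Num.Theory.
Local Open Scope ring_scope.

(** * Enumerating the request sequences over finitely many pages *)

Fixpoint words (T : Type) (pages : seq T) (n : nat) : seq (seq T) :=
  if n is n'.+1 then [seq p :: s | p <- pages, s <- words pages n'] else [:: [::]].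

Lemma size_words (T : Type) (pages : seq T) n : size (words pages n) = (size pages ^ n)%N.
Proof. by elim: n => //= n IHn; rewrite size_allpairs IHn expnS. Qed.

Lemma size_mem_words (T : eqType) (pages : seq T) n s :
  s \in words pages n -> size s = n.
Proof.
elim: n s => [|n IHn] s /=; first by rewrite inE => /eqP ->.
by move=> /allpairsP[[p s'] /= [_ /IHn <- ->]].
Qed.

Lemma subset_mem_words (T : eqType) (pages : seq T) n s :
  s \in words pages n -> {subset s <= pages}.
Proof.
elim: n s => [|n IHn] s /=; first by rewrite inE => /eqP ->.
move=> /allpairsP[[p s'] /= [pp /IHn sp ->]] x.
by rewrite inE => /orP[/eqP ->|/sp].
Qed.

Lemma sum_wordsS (T : Type) (V : nmodType) (pages : seq T) n (F : seq T -> V) :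
  \sum_(s <- words pages n.+1) F s =
  \sum_(p <- pages) \sum_(s <- words pages n) F (p :: s).
Proof. by rewrite /= big_allpairs_dep. Qed.

Lemma sumr_if_mem (T : eqType) (V : nmodType) (S l : seq T) (a b : V) :
  uniq S -> uniq l -> {subset S <= l} ->
  \sum_(p <- l) (if p \in S then a else b) = a *+ size S + b *+ (size l - size S).
Proof.
move=> uS ul sSl.
have cS : count [in S] l = size S.
  rewrite -size_filter; apply/perm_size/uniq_perm => //; first exact: filter_uniq.
  by move=> x; rewrite mem_filter andb_idr //; exact: sSl.
have -> : (size l - size S)%N = count [predC S] l.
  by rewrite -(count_predC [in S] l) cS addKn.
rewrite -[in RHS]cS -!iter_addr_0 -!big_const_seq [LHS](bigID [in S]) /=.
by congr (_ + _); apply: eq_bigr => p; [move=> ->|move=> /negbTE ->].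
Qed.

(** * Caches that miss a single page *)

(** With k + 1 distinct pages, [h] determines the set of cached pages; only their placement in the
    slots stays free. *)
Definition hole k (pages : seq nat) (C : cache k) (h : nat) : Prop :=
  [/\ injective C, forall i, C i \in pages, h \in pages & forall i, C i != h].

Lemma in_cacheE k (C : cache k) p : in_cache C p = (p \in codom C).
Proof.
apply/existsP/codomP => [[i /eqP <-]|[i ->]]; exists i => //.
Qed.

Lemma hole_in_cache k pages (C : cache k) h p :
  uniq pages -> size pages = k.+1 -> hole pages C h -> p \in pages ->
  in_cache C p = (p != h).
Proof.
move=> up sp [injC Cp hp Ch] pp.
have uC : uniq (h :: codom C).
  rewrite /= andbC map_inj_uniq ?enum_uniq //.
  by apply/negP => /codomP[i E]; have := Ch i; rewrite E eqxx.
have sC : {subset h :: codom C <= pages}.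
  by move=> x; rewrite inE => /orP[/eqP -> //|/codomP[i ->]].
have [|_ E] := uniq_min_size uC sC; first by rewrite /= size_codom card_ord sp.
have := E p; rewrite pp inE in_cacheE.
case: eqP => [->|_] /=; last by move=> ->.
by move=> _; apply/negbTE; case/andP: uC.
Qed.

Lemma hole_serve k pages (C : cache k) h i :
  hole pages C h -> hole pages (serve C h i) (C i).
Proof.
move=> [injC Cp hp Ch].
have -> : serve C h i = [ffun j => if j == i then h else C j].
  rewrite /serve; case: ifP => // /existsP[j Ej].
  by have := Ch j; rewrite Ej.
split => // [x y|j|j]; rewrite ?ffunE.
- case: eqP => [->|nx]; case: eqP => [->|ny] //.
  + by move=> E; have := Ch y; rewrite -E eqxx.
  + by move=> E; have := Ch x; rewrite E eqxx.
  + exact: injC.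
- by case: eqP.
- case: (eqVneq j i) => [_|nj]; first by rewrite eq_sym.
  by apply: contra_neq nj => /injC.
Qed.

Lemma serve_hit k (C : cache k) p i : in_cache C p -> serve C p i = C.
Proof. by rewrite /serve => ->. Qed.

(** Exactly one of the k + 1 next requests faults, and every eviction leaves a single hole again. So
    each request contributes the factor k + t, t = [expR a], whatever the rule. *)
Lemma sum_expR_faults (R : realType) k pages (d : decision k) (a : R) n pre C h :
  uniq pages -> size pages = k.+1 -> hole pages C h ->
  \sum_(s <- words pages n) expR (a * (faults_from d pre C s)%:R) =
  (k%:R + expR a) ^+ n.
Proof.
move=> up sp; elim: n pre C h => [|n IHn] pre C h hC.
  by rewrite /= big_seq1 mulr0 expR0.
have hp : h \in pages by case: hC.
rewrite sum_wordsS exprS mulrDl.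
transitivity (\sum_(p <- pages) if p \in [:: h]
    then expR a * (k%:R + expR a) ^+ n else (k%:R + expR a) ^+ n).
  apply: eq_big_seq => p pp /=; rewrite (hole_in_cache up sp hC pp) negbK.
  rewrite inE; case: (eqVneq p h) => [->|ph] /=.
    rewrite -(IHn (rcons pre h) _ _ (hole_serve (d pre h) hC)) big_distrr.
    by apply: eq_bigr => s _; rewrite natrD mulrDr mulr1 expRD.
  rewrite serve_hit ?(hole_in_cache up sp hC pp) //.
  by rewrite -(IHn (rcons pre p) _ _ hC).
rewrite sumr_if_mem //; last by move=> x; rewrite inE => /eqP ->.
by rewrite sp /= mulr1n subn1 /= addrC mulr_natl.
Qed.

(** * The offline optimum and the phase partition *)

(** [S] lists the distinct pages of the current phase; only phases opened after it count. The
    theorem starts with [S] the initial cache, a full phase. *)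
Fixpoint new_phases (k : nat) (S s : seq nat) : nat :=
  if s is p :: s' then
    if p \in S then new_phases k S s'
    else if (size S < k)%N then new_phases k (p :: S) s'
    else (new_phases k [:: p] s').+1
  else 0.

(** A rule is consulted only on histories at least as long as [pre], so two strategies can be glued
    by history length. *)
Lemma faults_from_ext k (d d' : decision k) pre C s :
  (forall q p, (size pre <= size q)%N -> d q p = d' q p) ->
  faults_from d pre C s = faults_from d' pre C s.
Proof.
elim: s pre C => //= p s IHs pre C E; rewrite (E pre) // (IHs (rcons pre p)) //.
by move=> q r; rewrite size_rcons => /ltnW; exact: E.
Qed.

Lemma exists_not_mem (T : eqType) (S l : seq T) :
  uniq l -> (size S < size l)%N -> exists2 h, h \in l & h \notin S.
Proof.
move=> ul; rewrite ltnNge => /negP nle; apply: contrapT => H; apply: nle.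
apply: uniq_leq_size => // x xl; apply: contrapT => xS.
by apply: H; exists x => //; apply/negP.
Qed.

(* Within a phase at most k distinct pages occur, so a strategy knowing the
   future can keep missing a page that is not requested before the next phase. *)
Lemma offline_hole k (pages s S : seq nat) :
  uniq pages -> size pages = k.+1 -> (0 < k)%N ->
  uniq S -> {subset S <= pages} -> (size S <= k)%N -> {subset s <= pages} ->
  exists2 h, (h \in pages) && (h \notin S) &
    forall C pre, hole pages C h ->
    exists d : decision k, (faults_from d pre C s <= new_phases k S s)%N.
Proof.
move=> up sp k0; elim: s S => [|p s IHs] S uS sS leS sub.
  have [|h hp hS] := exists_not_mem (S := S) up; first by rewrite sp.
  by exists h => [|C pre _]; [rewrite hp|exists (fun _ _ => Ordinal k0)].
have pp : p \in pages by apply: sub; rewrite mem_head.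
have {}sub : {subset s <= pages} by move=> x xs; apply: sub; rewrite inE xs orbT.
have hit T h : (h \in pages) && (h \notin T) -> p \in T ->
    (forall C pre, hole pages C h -> exists d : decision k,
       (faults_from d pre C s <= new_phases k T s)%N) ->
    forall C pre, hole pages C h -> exists d : decision k,
       (faults_from d pre C (p :: s) <= new_phases k T s)%N.
  move=> /andP[hp hT] pT H C pre hC.
  have inC : in_cache C p.
    by rewrite (hole_in_cache up sp hC pp); apply: contraNneq hT => <-.
  have [d Hd] := H C (rcons pre p) hC.
  by exists d; rewrite /= inC serve_hit.
case pS: (p \in S).
  have [h hh H] := IHs S uS sS leS sub.
  by exists h => //= C pre hC; rewrite pS; exact: (hit S h).
have sp1 : {subset [:: p] <= pages} by move=> x; rewrite inE => /eqP ->.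
case: (ltnP (size S) k) => ltS.
  have [||h hh H] := IHs (p :: S) _ _ ltS sub; first by rewrite /= pS.
    by move=> x; rewrite inE => /orP[/eqP ->|/sS].
  exists h => /=; first by move: hh; rewrite inE negb_or => /and3P[-> _ ->].
  by move=> C pre hC; rewrite pS ltS; apply: (hit (p :: S) h) => //; rewrite mem_head.
have [h hh H] := IHs [:: p] isT sp1 k0 sub.
(* The hole is the page opening the next phase: its fault pays for that phase, and the eviction
   moves the hole to [h], suited to the rest. *)
exists p => /=; first by rewrite pp pS.
move=> C pre hC; rewrite pS ltnNge ltS /=.
move: hh; rewrite inE => /andP[hp np].
have : in_cache C h by rewrite (hole_in_cache up sp hC hp).
move=> /existsP[i /eqP Ci].
have := hole_serve i hC; rewrite Ci => /(H _ (rcons pre p))[d Hd].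
exists (fun q r => if (size q <= size pre)%N then i else d q r).
rewrite leqnn (faults_from_ext (d' := d)) => [|q r].
  by move: Hd; case: (in_cache _ _) => /=; lia.
by rewrite size_rcons ltnNge => /negbTE ->.
Qed.

Lemma exists_opt k (C0 : cache k) s : (0 < k)%N -> exists m, is_opt C0 s m.
Proof.
move=> k0.
have ex : exists m, `[< exists d : decision k, cost C0 d s = m >].
  by exists (cost C0 (fun _ _ => Ordinal k0) s); apply/asboolP; eexists.
case: (ex_minnP ex) => m /asboolP[d Hd] min; exists m; split; first by exists d.
by move=> d'; apply: min; apply/asboolP; exists d'.
Qed.

(** * The mean number of phases *)

Lemma harmonic0 (R : realType) : harmonic R 0 = 0.
Proof. by rewrite /harmonic big_geq. Qed.

Lemma harmonicS (R : realType) m :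
  harmonic R m.+1 = harmonic R m + (m.+1%:R)^-1.
Proof. by rewrite /harmonic big_nat_recr. Qed.

Lemma ler_harmonic (R : realType) m n :
  (m <= n)%N -> harmonic R m <= harmonic R n.
Proof.
move=> /subnK <-; elim: (n - m)%N => // i IHi.
by rewrite addSn harmonicS (le_trans IHi) // lerDl invr_ge0.
Qed.

(* [(k+1) H_(k+1-j)] is the expected time to the next phase when the current
   one has seen [j] pages, so that [(k+1) H_k] times the number of new phases
   minus this quantity minus the time is a martingale. *)
Lemma sum_new_phases (R : realType) k (pages S : seq nat) n :
  uniq pages -> size pages = k.+1 -> (0 < k)%N ->
  uniq S -> {subset S <= pages} -> (0 < size S <= k)%N ->
  k.+1%:R * harmonic R k * \sum_(s <- words pages n) (new_phases k S s)%:R <=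
  k.+1%:R ^+ n * (n%:R + k.+1%:R * (harmonic R k - harmonic R (k.+1 - size S))).
Proof.
move=> up sp k0; elim: n S => [|n IHn] S uS sS /andP[S0 Sk].
  rewrite /= big_seq1 mulr0 expr0 mul1r add0r mulr_ge0 // subr_ge0.
  by apply: ler_harmonic; lia.
pose B j : R := k.+1%:R ^+ n * (n%:R + k.+1%:R * (harmonic R k - harmonic R (k.+1 - j))).
have M0 : 0 <= k.+1%:R ^+ n :> R by rewrite exprn_ge0.
rewrite sum_wordsS big_distrr /=.
apply: le_trans (_ : \sum_(p <- pages) (if p \in S then B (size S) else B (size S).+1) <= _).
  rewrite big_seq [leRHS]big_seq; apply: ler_sum => p pp.
  have sp1 : {subset [:: p] <= pages} by move=> x; rewrite inE => /eqP ->.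
  case pS: (p \in S); first by apply: IHn; rewrite ?S0.
  case: (ltnP (size S) k) => ltS.
    apply: (IHn (p :: S)) => //=; first by rewrite pS.
    by move=> x; rewrite inE => /orP[/eqP ->|/sS].
  (* A new phase adds (k + 1) H_k per sequence, the gap between [B 1] and [B k.+1] since H_0 = 0. *)
  have -> : size S = k by lia.
  under eq_bigr do rewrite -natr1.
  rewrite big_split /= mulrDr big_const_seq count_predT size_words sp iter_addr_0.
  have := IHn [:: p] isT sp1 k0; rewrite /B /= subnn subn1 /= harmonic0 natrX.
  rewrite subrr mulr0 addr0 subr0 mulrDr => IH.
  by rewrite lerD // mulrC.
rewrite sumr_if_mem // sp -[X in X + _]mulr_natl -[X in _ + X]mulr_natl /B exprS subSS.
(* With j pages seen, k + 1 - j requests raise the potential by (k + 1) / (k + 1 - j): one unit of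
   time on average. *)
have kj : (k.+1 - size S = (k - size S).+1)%N by lia.
rewrite kj harmonicS -[(size S)%:R](addKr (k - size S).+1%:R) -natrD.
rewrite addSn subnK //.
rewrite -natr1 le_eqVlt; apply/orP; left; apply/eqP; field.
by rewrite natr1 pnatr_eq0.
Qed.

Lemma trace_faults k (d d' : decision k) pre C s :
  trace_from d pre C s = trace_from d' pre C s ->
  faults_from d pre C s = faults_from d' pre C s.
Proof.
elim: s pre C => //= p s IHs pre C [E]; rewrite E => /IHs ->.
by [].
Qed.

(** * Counting advice strings *)

(** Each sequence is served as by one of the 2^b rules given by b bits padded with [false]; summing
    over all of them only adds nonnegative terms. *)
Lemma sum_expR_advice (R : realType) k (pages : seq nat) (C0 : cache k) h
    (A : advice_alg k) (O : oracle) (a : R) b n :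
  uniq pages -> size pages = k.+1 -> hole pages C0 h ->
  (forall s, s \in words pages n -> reads_at_most C0 A (O s) s b) ->
  \sum_(s <- words pages n) expR (a * (cost C0 (A (O s)) s)%:R) <=
  2 ^+ b * (k%:R + expR a) ^+ n.
Proof.
move=> up sp hC rA.
apply: le_trans (_ : \sum_(s <- words pages n) \sum_(w : b.-tuple bool)
    expR (a * (cost C0 (A (nth false w)) s)%:R) <= _).
  rewrite big_seq [leRHS]big_seq; apply: ler_sum => s sw.
  rewrite (bigD1 [tuple of mkseq (O s) b]) //=.
  have E i : (i < b)%N -> nth false (mkseq (O s) b) i = O s i.
    by move=> ib; rewrite nth_mkseq.
  rewrite /cost (trace_faults (rA s sw _ E)) lerDl sumr_ge0 // => w _.
  exact: expR_ge0.
rewrite exchange_big /=.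
under eq_bigr do rewrite (sum_expR_faults _ _ _ _ up sp hC).
by rewrite sumr_const card_tuple card_bool -natrX mulr_natl.
Qed.

(** Jensen's inequality for exp, from its tangent line at [mu]. *)
Lemma expR_sum_ge (R : realType) (I : Type) (l : seq I) (F : I -> R) (mu : R) :
  (size l)%:R * mu <= \sum_(i <- l) F i ->
  (size l)%:R * expR mu <= \sum_(i <- l) expR (F i).
Proof.
move=> H; apply: le_trans (_ : \sum_(i <- l) expR mu * (1 + (F i - mu)) <= _).
  rewrite -big_distrr /= big_split /= sumrB !big_const_seq !count_predT !iter_addr_0.
  rewrite mulrC ler_pM2l ?expR_gt0 // lerDl subr_ge0.
  by rewrite -mulr_natl.
apply: ler_sum => i _; rewrite -[in leRHS](subrKC mu (F i)) expRD.
by rewrite ler_pM2l ?expR_gt0 // expR_ge1Dx.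
Qed.

(* [t] minimizes the Chernoff bound [((k + t) / (k + 1)) t^(-x)]. *)
Lemma KL_le_advice (R : realType) k (x : R) n b (t := x * k%:R / (1 - x)) :
  (0 < k)%N -> 0 < x -> x < 1 ->
  k.+1%:R ^+ n * expR (ln t * (x * n%:R)) <= 2 ^+ b * (k%:R + t) ^+ n ->
  KL (k.+1%:R^-1) x * n%:R <= b%:R.
Proof.
move=> k0 x0 x1.
have K0 : 0 < k%:R :> R by rewrite ltr0n.
have K1 : 0 < k.+1%:R :> R by rewrite ltr0n.
have y0 : 0 < 1 - x by rewrite subr_gt0.
have ktE : k%:R + t = k%:R / (1 - x) by rewrite /t; field; rewrite gt_eqF.
have l2 : 0 < ln 2 :> R by rewrite ln_gt0 // ltr1n.
rewrite ktE -ler_ln ?posrE ?mulr_gt0 ?exprn_gt0 ?expR_gt0 ?divr_gt0 //.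
have lnt : ln t = ln x + ln k%:R - ln (1 - x).
  by rewrite ln_div ?lnM ?posrE ?mulr_gt0.
have -> z : ln (k.+1%:R ^+ n * expR z) = n%:R * ln k.+1%:R + z :> R.
  by rewrite lnM ?posrE ?exprn_gt0 ?expR_gt0 // lnXn // expRK mulr_natl.
have -> : ln (2 ^+ b * (k%:R / (1 - x)) ^+ n) =
          b%:R * ln 2 + n%:R * (ln k%:R - ln (1 - x)) :> R.
  rewrite lnM ?posrE ?exprn_gt0 ?divr_gt0 // !lnXn ?divr_gt0 //.
  by rewrite ln_div ?posrE // !mulr_natl.
have KLE : KL k.+1%:R^-1 x * ln 2 =
    x * (ln x + ln k.+1%:R) + (1 - x) * (ln (1 - x) + ln k.+1%:R - ln k%:R).
  have -> : KL k.+1%:R^-1 x * ln 2 =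
      x * ln (x / k.+1%:R^-1) + (1 - x) * ln ((1 - x) / (1 - k.+1%:R^-1)).
    by rewrite /KL /log2; field; rewrite gt_eqF.
  have -> : (1 - x) / (1 - k.+1%:R^-1) = (1 - x) * k.+1%:R / k%:R.
    by rewrite -natr1; field; rewrite natr1 !pnatr_eq0 -lt0n k0.
  by rewrite invrK ln_div ?posrE ?mulr_gt0 // !lnM ?posrE.
rewrite lnt => H; rewrite -(ler_pM2r l2) mulrAC KLE; move: H.
move: (ln x) (ln k%:R) (ln k.+1%:R) (ln (1 - x)) (b%:R * ln 2) n%:R => *; lra.
Qed.

(** * Uniform advice length and choice of parameters *)

Lemma ex_common_bound (T : eqType) (P : T -> nat -> Prop) (Q : nat -> Prop)
    (l : seq T) b0 :
  (forall x b b', (b <= b')%N -> P x b -> P x b') -> Q b0 ->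
  (forall x, x \in l -> exists b, P x b /\ Q b) ->
  exists2 b, Q b & forall x, x \in l -> P x b.
Proof.
move=> mono Q0; elim: l => [|x l IHl] H; first by exists b0.
have [|b Qb Hb] := IHl; first by move=> y yl; apply: H; rewrite inE yl orbT.
have [b' [Px Qb']] := H x (mem_head _ _).
exists (maxn b b'); first by case: (leqP b b').
move=> y; rewrite inE => /orP[/eqP ->|/Hb Py].
- exact: mono (leq_maxr _ _) Px.
- exact: mono (leq_maxl _ _) Py.
Qed.

Theorem theorem12 (R : realType) (k : nat) (c : R) :
  1 < c -> c < harmonic R k ->
  forall eps : R, 0 < eps -> eps < (k.+1)%:R * (harmonic R k - c) ->
  exists n0 : nat,
    forall (C0 : cache k), injective C0 ->
    forall (A : advice_alg k) (O : oracle),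
      strictly_competitive C0 A O c ->
      forall n : nat, (n0 <= n)%N ->
        exists sigma : seq nat, size sigma = n /\
          forall b : nat, reads_at_most C0 A (O sigma) sigma b ->
            KL ((k.+1)%:R^-1) (c / ((k.+1)%:R * harmonic R k - eps) + c / n%:R)
               * n%:R <= b%:R.
Proof.
move=> c1 cH eps eps0 epsH.
have k0 : (0 < k)%N.
  by rewrite lt0n; apply: contraTneq cH => ->; rewrite harmonic0 -leNgt; lra.
have K1 : 0 < k.+1%:R :> R by rewrite ltr0n.
set L := k.+1%:R * harmonic R k; set D := L - eps.
have D_gt : k.+1%:R * c < D.
  by rewrite /D /L; move: epsH; rewrite mulrBr; lra.
have c0 : 0 < c by lra.
have D0 : 0 < D by apply: lt_trans D_gt; rewrite mulr_gt0.
(* The room left for c / n: n > c / [del] gives x <= 1 / (k + 1). *)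
pose del := k.+1%:R^-1 - c / D.
have del0 : 0 < del by rewrite subr_gt0 ltr_pdivrMr // ltr_pdivlMl.
have cd0 : 0 < c / del by rewrite divr_gt0.
exists (Num.bound (c / del)) => C0 injC A O comp n n0n.
have n_gt : c / del < n%:R.
  by rewrite (lt_le_trans (archi_boundP (ltW cd0))) // ler_nat.
have n0 : 0 < n%:R :> R by apply: lt_trans n_gt.
set x := c / D + c / n%:R.
have x0 : 0 < x by rewrite addr_gt0 ?divr_gt0.
have xy : x <= k.+1%:R^-1.
  rewrite /x -lerBrDl ler_pdivrMr // -ler_pdivrMl // mulrC; exact: ltW.
have x1 : x < 1.
  by apply: le_lt_trans xy _; rewrite invf_lt1 // ltr1n.
apply: contrapT => nosigma.
pose h := (\max_i C0 i).+1.
have Ch i : C0 i != h by rewrite neq_ltn ltnS (leq_bigmax i).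
pose pages := h :: codom C0.
have uC : uniq (codom C0) by rewrite map_inj_uniq ?enum_uniq.
have sC : size (codom C0) = k by rewrite size_codom card_ord.
have up : uniq pages.
  by rewrite /= uC andbT; apply/codomP => -[i E]; have := Ch i; rewrite -E eqxx.
have sp : size pages = k.+1 by rewrite /= sC.
have CsP : {subset codom C0 <= pages} by move=> p pC; rewrite inE pC orbT.
have hC : hole pages C0 h.
  by split => // [i|]; rewrite ?mem_head // CsP // codom_f.
(* If no [sigma] works, every sequence gets by with fewer bits than claimed; the maximum over the
   finitely many words is still too small. *)
have short s : size s = n -> exists b, reads_at_most C0 A (O s) s b /\
    (b%:R < KL k.+1%:R^-1 x * n%:R).
  move=> sn; apply: contrapT => nb; apply: nosigma; exists s; split=> // b rb.
  by rewrite leNgt; apply/negP => lb; apply: nb; exists b.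
have [b00 [_ lb00]] := short (nseq n 0%N) (size_nseq _ _).
have [||b lb rb] := @ex_common_bound _ (fun s b => reads_at_most C0 A (O s) s b)
    (fun b => b%:R < KL k.+1%:R^-1 x * n%:R) (words pages n) b00 _ lb00.
- by move=> s b b' bb' rb psi E; apply: rb => i ib; apply: E; exact: leq_trans bb'.
- by move=> s /size_mem_words; exact: short.
move: lb; apply/negP; rewrite -leNgt.
apply: KL_le_advice => //; set t := x * k%:R / (1 - x).
have t0 : 0 < t by rewrite !mulr_gt0 ?invr_gt0 ?ltr0n ?subr_gt0.
have t1 : t <= 1.
  rewrite ler_pdivrMr ?subr_gt0 // mul1r.
  move: xy; rewrite -(ler_pM2r K1) mulVf ?gt_eqF // -natr1; lra.
(* This sign turns upper bounds on the cost into lower bounds on the weight. *)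
have lnt : ln t <= 0 by rewrite ln_le0.
rewrite -[t in k%:R + t]lnK ?posrE //.
apply: le_trans (sum_expR_advice (ln t) up sp hC rb).
apply: le_trans (_ : \sum_(s <- words pages n)
    expR (ln t * (c * (new_phases k (codom C0) s)%:R)) <= _); last first.
  rewrite big_seq [leRHS]big_seq; apply: ler_sum => s sw.
  rewrite ler_expR ler_wnM2l //.
  have [m optm] := exists_opt C0 s k0.
  apply: le_trans (comp _ _ optm) _; rewrite ler_pM2l // ler_nat.
  (* Only [h] lies outside the initial cache, so the hole obtained is the actual one. *)
  have [|h' /andP[]] := offline_hole up sp k0 uC CsP _ (subset_mem_words sw).
    by rewrite sC.
  rewrite inE => /orP[/eqP -> _|-> //] /(_ C0 [::] hC)[d].
  by apply: leq_trans; case: optm => _; exact.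
rewrite -natrX -sp -size_words; apply: expR_sum_ge.
rewrite size_words sp natrX -big_distrr -big_distrr /= mulrCA ler_wnM2l //.
have := sum_new_phases R n up sp k0 uC CsP; rewrite sC k0 leqnn => /(_ isT).
rewrite subSnn -/L; set X := \sum_(_ <- _) _; set M := _ ^+ n => HX.
have L0 : 0 < L by rewrite mulr_gt0 // (lt_trans _ cH).
have M0 : 0 <= M by rewrite exprn_ge0.
(* The starting potential (k + 1)(H_k - 1) is at most [L]; the resulting + 1 becomes the term c / n
   of [x]. *)
have {}HX : X <= M * (n%:R / L + 1).
  rewrite -(ler_pM2l L0) (le_trans HX) // mulrCA ler_wpM2l //.
  have -> : L * (n%:R / L + 1) = n%:R + L by field; rewrite gt_eqF.
  rewrite lerD2l /L ler_pM2l //.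
  by rewrite gerBl harmonicS harmonic0 add0r invr1.
rewrite -ler_pdivlMl //; apply: le_trans HX _.
rewrite mulrCA ler_wpM2l //.
have -> : c^-1 * (x * n%:R) = n%:R / D + 1.
  by rewrite /x; field; rewrite !gt_eqF.
by rewrite lerD2r ler_pM2l // lef_pV2 // gerBl ltW.
Qed.
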